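(* Let $p$ be a prime, $\alpha\geq 1$ an integer, and $\Gamma=\mathrm{Cay}(\mathbb{Z}_{p}\times\mathbb{Z}_{p^{\alpha}},\Phi)$ with $\Phi=\varphi_p\times\varphi_{p^\alpha}$. Then (1) if $p=2$, $\gamma_t(\Gamma)=4$ and $\Gamma$ has no connected dominating set; (2) if $p\geq 3$, $\gamma_t(\Gamma)=\gamma_c(\Gamma)=3$.
   Context: For $n\geq 1$, $\mathbb{Z}_n=\{0,\dots,n-1\}$ is the integers mod $n$ and $\varphi_n$ is the set of elements of $\mathbb{Z}_n$ coprime to $n$ ($\varphi_p=\mathbb{Z}_p\setminus\{0\}$ for $p$ prime). $\mathrm{Cay}(\mathbb{Z}_p\times\mathbb{Z}_m,\varphi_p\times\varphi_m)$ is the graph on $\mathbb{Z}_p\times\mathbb{Z}_m$ where $(u,v)\sim(u',v')$ iff $u-u'\in\varphi_p$ and $v-v'\in\varphi_m$. A total dominating set is a vertex set $T$ such that every vertex is adjacent to some vertex of $T$; $\gamma_t$ is the minimum size of one. A connected dominating set is a dominating set inducing a connected subgraph; $\gamma_c$ is the minimum size of one. *)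

(* Defs.v *)
From HB Require Import structures.
From mathcomp Require Import all_boot all_algebra.

Set Implicit Arguments.
Unset Strict Implicit.
Unset Printing Implicit Defensive.

(* ['Z_n] is the ring of integers mod n only for n >= 2. *)
Definition phi (n : nat) : {set 'Z_n} := [set x : 'Z_n | coprime x n].

Definition Cay (G : zmodType) (S : {pred G}) : rel G :=
  fun x y => (x - y)%R \in S.

Section Domination.

Variables (T : finType) (e : rel T).
Implicit Type D : {set T}.

Definition dominating D : Prop :=
  forall x, x \notin D -> exists2 y, y \in D & e x y.

Definition total_dominating D : Prop :=
  forall x, exists2 y, y \in D & e x y.

Definition induced D : rel T :=
  fun x y => [&& x \in D, y \in D & e x y].

Definition induces_connected D : Prop :=
  D != set0 /\ {in D &, forall x y, connect (induced D) x y}.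

Definition connected_dominating D : Prop :=
  dominating D /\ induces_connected D.

(* The minimum is stated as a relation, since a graph may have no set
   satisfying [P]; [min_card P k] asserts that it is attained and equals k. *)
Definition min_card (P : {set T} -> Prop) (k : nat) : Prop :=
  (exists2 D, P D & #|D| = k) /\ (forall D, P D -> k <= #|D|).

Definition is_gamma_t (k : nat) : Prop := min_card total_dominating k.

Definition is_gamma_c (k : nat) : Prop := min_card connected_dominating k.

End Domination.

(* Main.v *)
(** As [p] is prime, two vertices are adjacent iff both their coordinates differ
    mod [p].  Hence no two vertices [d, d'] totally dominate, since the vertex
    [(d.1, d'.2)] is adjacent to neither of them, while for [p >= 3] the
    triangle [(0,0), (1,1), (2,2)] does.  A connected dominating set of size at
    least 2 is totally dominating.  For [p = 2] adjacency flips both parities, so a total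
    dominating set meets all four parity classes, and the parity of the
    coordinate sum is constant on components. *)
Require Import Defs.
From HB Require Import structures.
From mathcomp Require Import all_boot all_algebra.

Set Implicit Arguments.
Unset Strict Implicit.

Lemma connect_neighbour (T : finType) (e : rel T) (x y : T) :
  connect e x y -> x != y -> exists z, e x z.
Proof.
case/connectP=> [[|z s]] /= => [_ ->|/andP[exz _] _ _]; first by rewrite eqxx.
by exists z.
Qed.

(** A vertex of [D] has a path inside [D] to some other vertex of [D], and the first edge of that
    path gives its neighbour. *)
Lemma connected_dominating_total (T : finType) (e : rel T) (D : {set T}) :
  connected_dominating e D -> 1 < #|D| -> total_dominating e D.
Proof.
move=> [domD [_ conD]] /card_gt1P[a [b [aD bD neq_ab]]] x.
have [xD|/domD//] := boolP (x \in D).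
have [y yD neq_xy] : exists2 y, y \in D & x != y.
  have [xa|xa] := eqVneq x a; last by exists a.
  by exists b; rewrite ?xa.
have [z /and3P[_ zD exz]] := connect_neighbour (conD _ _ xD yD) neq_xy.
by exists z.
Qed.

Lemma connect_invariant (T : finType) (U : eqType) (e : rel T) (f : T -> U) :
  (forall x y, e x y -> f x = f y) -> forall x y, connect e x y -> f x = f y.
Proof.
move=> fe x y /connectP[s es ->].
by elim: s x es => //= z s IHs x /andP[/fe-> /IHs].
Qed.

Section CoordinatewiseDistinct.

(** [r1] and [r2] abstract reduction mod [p] on the two factors. *)
Variables (T1 T2 : finType) (U : eqType) (r1 : T1 -> U) (r2 : T2 -> U).
Variable e : rel (T1 * T2).
Hypothesis eE : forall x y, e x y = (r1 x.1 != r1 y.1) && (r2 x.2 != r2 y.2).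

Lemma total_dominating_gt2 (x0 : T1 * T2) (D : {set T1 * T2}) :
  total_dominating e D -> 2 < #|D|.
Proof.
move=> totD; rewrite ltnNge; apply/negP=> leD2.
have [d dD _] := totD x0.
have leD1 : #|D :\ d| <= 1 by rewrite (cardsD1 d D) dD in leD2.
have [D1|[d' d'D]] := set_0Vmem (D :\ d).
  have [y yD] := totD d; rewrite eE => /andP[neq _].
  have : y \in D :\ d by rewrite !inE yD andbT; apply: contraNneq neq => ->.
  by rewrite D1 inE.
(* The neighbour [y] differs from [d] in the first coordinate, so [y = d'], which contradicts the
   shared second coordinate. *)
have [y yD] := totD (d.1, d'.2); rewrite eE /= => /andP[neq1 neq2].
have yD1 : y \in D :\ d by rewrite !inE yD andbT; apply: contraNneq neq1 => ->.
by rewrite (card_le1_eqP leD1 y d') ?eqxx in neq2.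
Qed.

Lemma connected_dominating_gt2 (D : {set T1 * T2}) :
    (forall x : T2, exists y, r2 x != r2 y) ->
  connected_dominating e D -> 2 < #|D|.
Proof.
move=> exr2 conD; have [domD [/set0Pn[d dD] _]] := conD.
have [leD1|gtD1] := leqP #|D| 1; last first.
  exact/(total_dominating_gt2 d)/connected_dominating_total.
have Dd y : y \in D -> y = d by move=> yD; apply: (card_le1_eqP leD1).
(* A single vertex [d] does not dominate [(d.1, v)]: this vertex differs from [d] but shares its
   first coordinate. *)
have [v neq_v] := exr2 d.2.
have [|y /Dd->] := domD (d.1, v); last by rewrite eE eqxx.
by apply: contraNN neq_v => /Dd<-.
Qed.

Section Triangle.

Variables (t1 : 'I_3 -> T1) (t2 : 'I_3 -> T2).
Hypotheses (inj1 : injective (r1 \o t1)) (inj2 : injective (r2 \o t2)).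

Let tri : {set T1 * T2} := [set (t1 i, t2 i) | i : 'I_3].

Lemma card_triangle : #|tri| = 3.
Proof.
rewrite card_imset ?card_ord // => i j [eq1 _].
by apply: inj1; rewrite /= eq1.
Qed.

Lemma triangle_total_dominating : total_dominating e tri.
Proof.
move=> x.
have card_fiber (f : 'I_3 -> U) u : injective f -> #|[set i | f i == u]| <= 1.
  move=> inj_f; apply/card_le1_eqP=> i j.
  by rewrite !inE => /eqP fi /eqP fj; apply: inj_f; rewrite fi fj.
pose A := [set i | (r1 \o t1) i == r1 x.1].
pose B := [set i | (r2 \o t2) i == r2 x.2].
(* Each coordinate of [x] rules out at most one of the three indices, so some index survives
   both. *)
have ltAB : #|A :|: B| < 3.
  apply: leq_ltn_trans (leq_card_setU A B) _.
  by apply: leq_add (card_fiber _ (r1 x.1) inj1) (card_fiber _ (r2 x.2) inj2).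
have /subsetPn[i _] : ~~ ([set: 'I_3] \subset A :|: B).
  by apply: contraTN ltAB => /subset_leq_card; rewrite cardsT card_ord -leqNgt.
rewrite !inE negb_or /= => /andP[neq1 neq2].
exists (t1 i, t2 i); first exact: imset_f.
by rewrite eE /= (eq_sym (r1 _)) (eq_sym (r2 _)) neq1.
Qed.

Lemma triangle_connected_dominating : connected_dominating e tri.
Proof.
split; first by move=> x _; apply: triangle_total_dominating.
split; first by rewrite -card_gt0 card_triangle.
move=> _ _ /imsetP[i _ ->] /imsetP[j _ ->].
have [->|neq_ij] := eqVneq i j; first exact: connect0.
apply: connect1; rewrite /induced !imset_f //= eE /=.
by rewrite (inj_eq inj1) (inj_eq inj2) neq_ij.
Qed.

End Triangle.

End CoordinatewiseDistinct.

Section Parity.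

Variables (T1 T2 : finType) (r1 : T1 -> bool) (r2 : T2 -> bool).
Variables (s1 : bool -> T1) (s2 : bool -> T2).
Hypotheses (r1K : cancel s1 r1) (r2K : cancel s2 r2).
Variable e : rel (T1 * T2).
Hypothesis eE : forall x y, e x y = (r1 x.1 != r1 y.1) && (r2 x.2 != r2 y.2).

(** Every neighbour of a vertex with parities [(~~ a, ~~ b)] has parities [(a, b)], so [D] maps onto
    all four pairs. *)
Lemma parity_total_dominating_ge4 (D : {set T1 * T2}) :
  total_dominating e D -> 4 <= #|D|.
Proof.
move=> totD; pose f (x : T1 * T2) := (r1 x.1, r2 x.2).
suffices fD : f @: D = setT.
  have := leq_imset_card f D.
  by rewrite fD cardsT card_prod !card_bool.
apply/setP=> -[a b]; rewrite inE; apply/imsetP.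
have [y yD] := totD (s1 (~~ a), s2 (~~ b)).
rewrite eE /= r1K r2K => /andP[neq1 neq2]; exists y => //.
by rewrite /f; case: a b (r1 y.1) (r2 y.2) neq1 neq2 => -[] [] [].
Qed.

Lemma parity_gamma_t : is_gamma_t e 4.
Proof.
split; last exact: parity_total_dominating_ge4.
(* One representative per parity class; [x] is adjacent to that of the opposite class. *)
exists [set (s1 c.1, s2 c.2) | c : bool * bool]; last first.
  rewrite card_imset ?card_prod ?card_bool // => -[a b] [a' b'] /= [eq1 eq2].
  by rewrite -(r1K a) -(r2K b) eq1 eq2 r1K r2K.
move=> x; exists (s1 (~~ r1 x.1), s2 (~~ r2 x.2)).
  by apply/imsetP; exists (~~ r1 x.1, ~~ r2 x.2).
by rewrite eE /= r1K r2K; case: (r1 _) (r2 _) => -[].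
Qed.

Lemma parity_not_connected_dominating (D : {set T1 * T2}) :
  ~ connected_dominating e D.
Proof.
pose f (x : T1 * T2) := r1 x.1 (+) r2 x.2.
have fe x y : e x y -> f x = f y.
  rewrite eE /f => /andP[].
  by case: (r1 x.1) (r1 y.1) (r2 x.2) (r2 y.2) => -[] [] [].
move=> [domD [/set0Pn[d dD] conD]].
have fD y : y \in D -> f y = f d.
  move=> yD; apply: (connect_invariant _ (conD y d yD dD)) => u v.
  by case/and3P=> _ _ /fe.
(* Flipping only the second parity gives a vertex outside the component of [d], hence neither in [D]
   nor adjacent to it. *)
pose x := (s1 (r1 d.1), s2 (~~ r2 d.2)).
have fx : f x = ~~ f d by rewrite /f /= r1K r2K addbN.
have neq : f x <> f d by rewrite fx; case: (f d).
have [xD|/domD[y yD /fe]] := boolP (x \in D); first exact/neq/fD.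
by rewrite (fD y yD).
Qed.

End Parity.

(** Being coprime to [p ^ a] means not being divisible by [p], and since [p] divides [p ^ a],
    reduction mod [p] respects subtraction in the ring. *)
Lemma Zp_sub_phi (p a : nat) (x y : 'Z_(p ^ a)) : prime p -> 0 < a ->
  (x - y \in phi (p ^ a))%R = (x %% p != y %% p).
Proof.
move=> p_pr a_gt0.
have n_gt1 : 1 < p ^ a by rewrite -(exp1n a) ltn_exp2r // prime_gt1.
rewrite inE coprime_pexpr // coprime_sym prime_coprime //; congr (~~ _).
set d := (x - y)%R.
have xE : x = (d + y) %% (Zp_trunc (p ^ a)).+2 :> nat.
  exact: (congr1 val (esym (GRing.subrK y x))).
rewrite xE modn_dvdm ?Zp_cast ?dvdn_exp // -[X in _ == X %[mod _]]add0n.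
by rewrite eqn_modDr mod0n.
Qed.

Lemma val_Zp_nat_mod (p a k : nat) : prime p -> 0 < a ->
  (k%:R : 'Z_(p ^ a))%R %% p = k %% p.
Proof.
move=> p_pr a_gt0.
have n_gt1 : 1 < p ^ a by rewrite -(exp1n a) ltn_exp2r // prime_gt1.
by rewrite val_Zp_nat // modn_dvdm ?dvdn_exp.
Qed.

Theorem theorem2p2 (p alpha : nat) (p_prime : prime p) (alpha_ge1 : 1 <= alpha) :
  let Gamma : rel ('Z_p * 'Z_(p ^ alpha)) :=
    Cay (setX (phi p) (phi (p ^ alpha))) in
  (p = 2 ->
     is_gamma_t Gamma 4 /\ ~ (exists D, connected_dominating Gamma D)) /\
  (3 <= p ->
     is_gamma_t Gamma 3 /\ is_gamma_c Gamma 3).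
Proof.
move=> Gamma.
have eE x y : Gamma x y =
    (x.1 %% p != y.1 %% p) && (x.2 %% p != y.2 %% p).
  rewrite /Gamma /Cay in_setX Zp_sub_phi //; congr (_ && _).
  (* The first factor is the case of exponent 1, as [p ^ 1] is convertible to [p]. *)
  exact: (@Zp_sub_phi p 1).
have val1 k : (k%:R : 'Z_p)%R %% p = k %% p by apply: (@val_Zp_nat_mod p 1).
have val2 k : (k%:R : 'Z_(p ^ alpha))%R %% p = k %% p.
  exact: val_Zp_nat_mod.
clearbody Gamma; split=> [p2 | p_ge3].
  have eq_odd m k : (m %% p == k %% p) = (odd m == odd k).
    by rewrite p2 !modn2; do 2!case: odd.
  have eE2 x y : Gamma x y = (odd x.1 != odd y.1) && (odd x.2 != odd y.2).
    by rewrite eE !eq_odd.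
  have K1 : cancel (fun b : bool => b%:R : 'Z_p)%R (fun x => odd x).
    by case; apply/eqP; rewrite -[X in _ == X]oddb -eq_odd val1.
  have K2 : cancel (fun b : bool => b%:R : 'Z_(p ^ alpha))%R (fun x => odd x).
    by case; apply/eqP; rewrite -[X in _ == X]oddb -eq_odd val2.
  split; first exact: (parity_gamma_t K1 K2 eE2).
  by case=> D; apply: (parity_not_connected_dominating K1 K2 eE2).
pose t1 (i : 'I_3) : 'Z_p := (i%:R)%R.
pose t2 (i : 'I_3) : 'Z_(p ^ alpha) := (i%:R)%R.
(* The residues 0, 1, 2 stay distinct mod [p] because [p >= 3]. *)
have small (i : 'I_3) : i %% p = i by rewrite modn_small // (leq_trans _ p_ge3).
pose r1 (x : 'Z_p) := x %% p.
pose r2 (x : 'Z_(p ^ alpha)) := x %% p.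
have eEr x y : Gamma x y = (r1 x.1 != r1 y.1) && (r2 x.2 != r2 y.2).
  exact: eE.
have inj1 : injective (r1 \o t1).
  by move=> i j; rewrite /r1 /= !val1 !small => /val_inj.
have inj2 : injective (r2 \o t2).
  by move=> i j; rewrite /r2 /= !val2 !small => /val_inj.
have exr2 (x : 'Z_(p ^ alpha)) : exists y, r2 x != r2 y.
  (* The successor of [x] has another residue mod [p], even when it wraps around to 0. *)
  exists (x.+1%:R)%R; rewrite /r2 val2 -(addn1 x) -[X in X %% p == _]addn0.
  by rewrite eqn_modDl mod0n modn_small // prime_gt1.
have card_tri := card_triangle t2 inj1.
split; split.
- exists [set (t1 i, t2 i) | i : 'I_3] => //.
  exact: (triangle_total_dominating eEr inj1 inj2).
- by move=> D; apply: (total_dominating_gt2 eEr (0, 0)%R).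
- exists [set (t1 i, t2 i) | i : 'I_3] => //.
  exact: (triangle_connected_dominating eEr inj1 inj2).
- by move=> D; apply: (connected_dominating_gt2 eEr exr2).
Qed.
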